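(* Let $A$ be a $K$-algebra and $n\geq 1$ an integer. The sets $\mathcal{T}^n_A$ (twisting maps $\tau:K^n\otimes A\to A\otimes K^n$), $\mathcal{E}^n_A$ (systems of endomorphisms) and $\mathcal{R}^n_A$ (admissible pairs of order $n$ for $A$) are in one-to-one correspondence. The correspondences are $\tau\mapsto \boldsymbol{E}_\tau$ from $\mathcal{T}^n_A$ to $\mathcal{E}^n_A$ and $\boldsymbol{E}\mapsto(\Gamma_{\boldsymbol{E}},R_{\boldsymbol{E}})$ from $\mathcal{E}^n_A$ to $\mathcal{R}^n_A$.
   Context: $K$ is a field; algebras are associative, unital and nonzero; $\otimes=\otimes_K$. $\{e_1,\ldots,e_n\}$ is the canonical basis of the algebra $K^n$, so $1_{K^n}=\sum_i e_i$. For an algebra $B$, $m_B$ denotes its multiplication; the name of an algebra also denotes its identity map. Twisting maps: $\mathcal{T}^n_A$ is the set of $K$-linear maps $\tau:K^n\otimes A\to A\otimes K^n$ with $\tau(m_{K^n}\otimes A)=(A\otimes m_{K^n})(\tau\otimes K^n)(K^n\otimes\tau)$, $\tau(K^n\otimes m_A)=(m_A\otimes K^n)(A\otimes\tau)(\tau\otimes A)$, $\tau(1_{K^n}\otimes a)=a\otimes 1_{K^n}$ for all $a\in A$, and $\tau(x\otimes 1_A)=1_A\otimes x$ for all $x\in K^n$. To a $K$-linear map $\tau:K^n\otimes A\to A\otimes K^n$ one associates the unique family $\boldsymbol{E}_\tau=(E_{ij})_{i,j=1,\ldots,n}$ of $K$-linear endomorphisms of $A$ with $\tau(e_i\otimes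 a)=\sum_{j=1}^n E_{ij}(a)\otimes e_j$ for all $a\in A$ and all $i$. $\mathcal{E}^n_A$ is the set of families $(E_{ij})_{i,j=1,\ldots,n}$ of $K$-linear endomorphisms of $A$ such that, for all $i,j,p\in\{1,\dots,n\}$ and $a,b\in A$: $E_{ip}\circ E_{jp}=\delta_{i,j}E_{ip}$; $E_{ij}(ab)=\sum_{p=1}^n E_{ip}(a)E_{pj}(b)$; $\sum_{i=1}^n E_{ij}=\mathrm{Id}_A$; $E_{ij}(1_A)=\delta_{i,j}1_A$. A quiver $\Gamma$ has a vertex set $\Gamma^0$, an arrow set $\Gamma^1$, and source and target maps $s,t:\Gamma^1\to\Gamma^0$. $\Gamma^1(i,j)$ is the set of arrows from $i$ to $j$, and $\Gamma^2(i,j)$ is the set of pairs $(\alpha_1,\alpha_2)$ of arrows with $s(\alpha_1)=i$, $t(\alpha_1)=s(\alpha_2)$, $t(\alpha_2)=j$. For $\boldsymbol{E}\in\mathcal{E}^n_A$, the quiver $\Gamma_{\boldsymbol{E}}$ has vertices $1,\ldots,n$ and exactly one arrow from $i$ to $j$ if $E_{ij}\neq 0$, and none otherwise. $R_{\boldsymbol{E}}$ is the representation of $\Gamma_{\boldsymbol{E}}$ with the vector space $A$ at every vertex and the map $\varphi_\alpha=E_{s(\alpha),t(\alpha)}$ at every arrow $\alpha$. An admissible pair of order $n$ for $A$ is a pair $(\Gamma,R)$ where: (1) $\Gamma$ is a quiver with vertex set $\{1,\ldots,n\}$, without multiple arrows (so an arrow is identified with the pair (source, target)), such that every vertex carries a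 loop; (2) $R$ is a representation of $\Gamma$ with the vector space $A$ at every vertex, given by a family $(\varphi_\alpha)_{\alpha\in\Gamma^1}$ of nonzero $K$-linear maps $A\to A$ which is (a) splitted: for every vertex $i$ and all arrows $\alpha',\alpha''$ with target $i$, $\varphi_{\alpha'}\circ\varphi_{\alpha''}=\delta_{s(\alpha'),s(\alpha'')}\varphi_{\alpha'}$, and $\sum_{t(\alpha)=i}\varphi_\alpha=\mathrm{Id}_A$; (b) unital: $\varphi_\alpha(1_A)=\delta_{s(\alpha),t(\alpha)}1_A$ for every arrow $\alpha$; (c) factorizable: for all vertices $i,j$ and $a,b\in A$, $\sum_{(\alpha_1,\alpha_2)\in\Gamma^2(i,j)}\varphi_{\alpha_1}(a)\varphi_{\alpha_2}(b)$ equals $\varphi_\alpha(ab)$ if $\Gamma^1(i,j)=\{\alpha\}$, and equals $0$ if $\Gamma^1(i,j)=\emptyset$. $\mathcal{R}^n_A$ is the set of all admissible pairs of order $n$ for $A$. *)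

(* Defs.v *)
From HB Require Import structures.
From mathcomp Require Import all_boot all_order all_algebra.
From mathcomp Require Import freeg.
From mathcomp Require Import boolp classical_sets functions.

Set Implicit Arguments.
Unset Strict Implicit.
Unset Printing Implicit Defensive.

Import GRing.Theory.
Local Open Scope ring_scope.
Local Open Scope quotient_scope.

Section LinearExt.
Variables (K : fieldType) (U V : lmodType K).

Lemma linear_ext (f g : {linear U -> V}) : f =1 g -> f = g.
Proof.
case: f => f [fa fs]; case: g => g [ga gs] /= /funext fg.
move: fa fs; rewrite {}fg => fa fs.
congr (GRing.Linear.Pack (GRing.Linear.Class _ _)).
  case: fa ga {fs gs} => [p] [q]; congr (Algebra.isNmodMorphism.Axioms_ _).
  exact: Prop_irrelevance.
case: fs gs => [p] [q]; congr (GRing.isScalable.Axioms_ _).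
exact: Prop_irrelevance.
Qed.

End LinearExt.

(* The tensor product over K: the free module on U * V modulo the submodule   *)
(* generated by the bilinearity relations.                                    *)
Section Tensor.
Variables (K : fieldType) (U V : lmodType K).

Local Notation F := {freeg (U * V)%type / K}.
Local Notation gen u v := (Freeg [:: (1, (u, v))] : F).

Inductive tensor_rel : F -> Prop :=
| tensor_rel0 : tensor_rel 0
| tensor_relP c x y : tensor_rel x -> tensor_rel y -> tensor_rel (c *: x + y)
| tensor_relDl u u' v :
    tensor_rel (gen (u + u') v - (gen u v + gen u' v))
| tensor_relDr u v v' :
    tensor_rel (gen u (v + v') - (gen u v + gen u v'))
| tensor_relZl c u v : tensor_rel (gen (c *: u) v - c *: gen u v)
| tensor_relZr c u v : tensor_rel (gen u (c *: v) - c *: gen u v).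

Definition tensor_relb : {pred F} := fun x => `[< tensor_rel x >].

Lemma tensor_relZ c x : tensor_rel x -> tensor_rel (c *: x).
Proof.
by move=> rx; rewrite -[_ *: _]addr0; apply: tensor_relP tensor_rel0.
Qed.

Lemma tensor_rel_zmod : zmod_closed tensor_relb.
Proof.
split=> [|x y]; first exact/asboolP/tensor_rel0.
move=> /asboolP rx /asboolP ry; apply/asboolP.
by rewrite addrC -scaleN1r; apply: tensor_relP.
Qed.

HB.instance Definition _ :=
  GRing.isZmodClosed.Build F tensor_relb tensor_rel_zmod.

Definition tensor : predArgType := Quotient.quot (tensor_relb : zmodClosed F).

HB.instance Definition _ := GRing.Zmodule.on tensor.

Local Notation piT :=
  (\pi_(Quotient.quot (tensor_relb : zmodClosed F)) : F -> tensor).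

Lemma piT_eq x y : tensor_rel (x - y) -> piT x = piT y.
Proof. by move=> r; apply/eqP; rewrite -Quotient.idealrBE; apply/asboolP. Qed.

Lemma piT_rel x y : piT x = piT y -> tensor_rel (x - y).
Proof. by move=> /eqP; rewrite -Quotient.idealrBE => /asboolP. Qed.

Lemma piTD x y : piT (x + y) = piT x + piT y.
Proof. exact: raddfD. Qed.

Lemma piT_repr (x : tensor) : piT (repr x) = x.
Proof. exact: reprK. Qed.

Definition tensor_scale (c : K) (x : tensor) : tensor := piT (c *: repr x).

Lemma tensor_scaleE c x : tensor_scale c (piT x) = piT (c *: x).
Proof.
apply: piT_eq; rewrite -scalerBr; apply: tensor_relZ; apply: piT_rel.
exact: piT_repr.
Qed.

Lemma tensor_scaleA c d x :
  tensor_scale c (tensor_scale d x) = tensor_scale (c * d) x.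
Proof. by rewrite -(piT_repr x) !tensor_scaleE scalerA. Qed.

Lemma tensor_scale1 : left_id 1 tensor_scale.
Proof. by move=> x; rewrite -(piT_repr x) tensor_scaleE scale1r. Qed.

Lemma tensor_scaleDr : right_distributive tensor_scale +%R.
Proof.
move=> c x y; rewrite -(piT_repr x) -(piT_repr y) -piTD.
by rewrite !tensor_scaleE scalerDr piTD.
Qed.

Lemma tensor_scaleDl x : {morph tensor_scale^~ x : c d / c + d}.
Proof.
by move=> c d; rewrite -(piT_repr x) !tensor_scaleE scalerDl piTD.
Qed.

HB.instance Definition _ := GRing.Zmodule_isLmodule.Build K tensor
  tensor_scaleA tensor_scale1 tensor_scaleDr tensor_scaleDl.

Definition tens (u : U) (v : V) : tensor := piT (gen u v).

Lemma tens_bilinear : bilinear_for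
  (GRing.Scale.Law.clone _ _ *:%R _) (GRing.Scale.Law.clone _ _ *:%R _) tens.
Proof.
have DZ (c : K) (x : F) : c *: piT x = piT (c *: x) by exact: tensor_scaleE.
split=> [v|u] c x y /=; rewrite /tens DZ -piTD.
- transitivity (piT (gen (c *: x) v + gen y v)).
    exact/piT_eq/tensor_relDl.
  apply: piT_eq; rewrite opprD addrACA subrr addr0; exact: tensor_relZl.
- transitivity (piT (gen u (c *: x) + gen u y)).
    exact/piT_eq/tensor_relDr.
  apply: piT_eq; rewrite opprD addrACA subrr addr0; exact: tensor_relZr.
Qed.

HB.instance Definition _ :=
  bilinear_isBilinear.Build K U V tensor _ _ tens tens_bilinear.


Lemma freegUZ (c : K) (z : U * V) :
  (Freeg [:: (c, z)] : F) = c *: (Freeg [:: (1, z)] : F).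
Proof. by apply/eqP/freeg_eqP=> x; rewrite coeffZ !coeffU mul1r. Qed.

Lemma tensor_ind (P : tensor -> Prop) :
  (forall u v, P (tens u v)) -> P 0 ->
  (forall c x y, P x -> P y -> P (c *: x + y)) -> forall x, P x.
Proof.
move=> Pt P0 PD x; rewrite -(piT_repr x) -[repr x]freeg_sumE.
elim: (dom _) => [|[u v] s IHs]; first by rewrite big_nil raddf0.
rewrite big_cons piTD freegUZ -tensor_scaleE; exact: (PD _ _ _ (Pt u v) IHs).
Qed.

Lemma tensor_ext (W : lmodType K) (f g : {linear tensor -> W}) :
  (forall u v, f (tens u v) = g (tens u v)) -> f =1 g.
Proof.
move=> fg; apply: tensor_ind=> [//||c x y fx fy]; first by rewrite !linear0.
by rewrite !linearP fx fy.
Qed.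

Section Lift.
Variables (W : lmodType K) (f : {bilinear U -> V -> W}).

Local Notation fF := (fglift (fun uv : U * V => f uv.1 uv.2) : F -> W).

Let fFB x y : fF (x - y) = fF x - fF y.
Proof. exact: lift_is_additive. Qed.

Let fF0 : fF 0 = 0.
Proof. by rewrite -[0](subrr 0) fFB subrr. Qed.

Let fFN x : fF (- x) = - fF x.
Proof. by rewrite -[- x]add0r fFB fF0 sub0r. Qed.

Let fFD x y : fF (x + y) = fF x + fF y.
Proof. by rewrite -[y]opprK fFB !fFN !opprK. Qed.

Let fFZ c x : fF (c *: x) = c *: fF x.
Proof.
rewrite -[x]freeg_sumE; elim: (dom x) => [|z s IHs].
  by rewrite big_nil scaler0 fF0 scaler0.
rewrite big_cons scalerDr !fFD IHs scalerDr; congr (_ + _).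
by rewrite freegUZ scalerA -!freegUZ !liftU scalerA.
Qed.

Lemma tensor_rel_lift x : tensor_rel x -> fF x = 0.
Proof.
have fFg u v : fF (gen u v) = f u v by rewrite liftU scale1r.
elim=> {x} [|c x y _ fx _ fy|u u' v|u v v'|c u v|c u v].
- exact: fF0.
- by rewrite fFD fFZ fx fy scaler0 addr0.
- by rewrite fFB fFD !fFg linearDl subrr.
- by rewrite fFB fFD !fFg linearDr subrr.
- by rewrite fFB fFZ !fFg linearZl_LR subrr.
- by rewrite fFB fFZ !fFg linearZr_LR subrr.
Qed.

Definition tlift (x : tensor) : W := fF (repr x).

Lemma tlift_pi x : tlift (piT x) = fF x.
Proof.
apply/eqP; rewrite -subr_eq0 -fFB; apply/eqP/tensor_rel_lift/piT_rel.
exact: piT_repr.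
Qed.

Lemma tliftE u v : tlift (tens u v) = f u v.
Proof. by rewrite tlift_pi liftU scale1r. Qed.

Lemma tlift_linear : linear tlift.
Proof.
move=> c x y; rewrite -(piT_repr x) -(piT_repr y).
have -> : c *: piT (repr x) = piT (c *: repr x) by exact: tensor_scaleE.
by rewrite -piTD !tlift_pi fFD fFZ.
Qed.

HB.instance Definition _ :=
  GRing.isLinear.Build K tensor W _ tlift tlift_linear.

Lemma tlift_unique (h : {linear tensor -> W}) :
  (forall u v, h (tens u v) = f u v) -> h =1 tlift.
Proof. by move=> hf; apply: tensor_ext => u v; rewrite hf /= tliftE. Qed.

End Lift.
End Tensor.

Arguments tens {K U V} u v.

Notation "U ⊗ V" := (tensor U V) (at level 40, left associativity) : type_scope.
Notation "u ⊗t v" := (tens u v) (at level 40, left associativity) : ring_scope.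

Section TensorMap.
Variables (K : fieldType) (U U' V V' : lmodType K).
Variables (f : {linear U -> U'}) (g : {linear V -> V'}).

Definition tmap_fun (u : U) (v : V) : U' ⊗ V' := f u ⊗t g v.

Lemma tmap_bilinear : bilinear_for
  (GRing.Scale.Law.clone _ _ *:%R _) (GRing.Scale.Law.clone _ _ *:%R _) tmap_fun.
Proof.
split=> [v|u] c x y; rewrite /tmap_fun linearP; first exact: linearPl.
exact: linearPr.
Qed.

HB.instance Definition _ :=
  bilinear_isBilinear.Build K U V (U' ⊗ V') _ _ tmap_fun tmap_bilinear.

Definition tmap : {linear U ⊗ V -> U' ⊗ V'} := tlift tmap_fun.

Lemma tmapE u v : tmap (u ⊗t v) = f u ⊗t g v.
Proof. exact: tliftE. Qed.

End TensorMap.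

Section TensorAssoc.
Variables (K : fieldType) (U V W : lmodType K).

Definition tassoc_in (w : W) (u : U) (v : V) : U ⊗ (V ⊗ W) := u ⊗t (v ⊗t w).

Lemma tassoc_in_bilinear w : bilinear_for
  (GRing.Scale.Law.clone _ _ *:%R _) (GRing.Scale.Law.clone _ _ *:%R _)
  (tassoc_in w).
Proof.
by split=> [v|u] c x y; rewrite /tassoc_in ?linearPl ?linearPr.
Qed.

HB.instance Definition _ w := bilinear_isBilinear.Build K U V (U ⊗ (V ⊗ W))
  _ _ (tassoc_in w) (tassoc_in_bilinear w).

Definition tassoc_fun (x : U ⊗ V) (w : W) := tlift (tassoc_in w) x.

Lemma tassoc_bilinear : bilinear_for
  (GRing.Scale.Law.clone _ _ *:%R _) (GRing.Scale.Law.clone _ _ *:%R _)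
  tassoc_fun.
Proof.
split=> [w|x] c y z; rewrite /tassoc_fun ?linearP //=.
elim/(@tensor_ind K U V): x => [u v||d x x' IHx IHx'].
- by rewrite !tliftE /= /tassoc_in !linearPr.
- by rewrite !linear0 addr0.
- by rewrite !linearP /= IHx IHx' !scalerDr addrACA.
Qed.

HB.instance Definition _ := bilinear_isBilinear.Build K (U ⊗ V) W (U ⊗ (V ⊗ W))
  _ _ tassoc_fun tassoc_bilinear.

Definition tassoc : {linear U ⊗ V ⊗ W -> U ⊗ (V ⊗ W)} := tlift tassoc_fun.

Lemma tassocE u v w : tassoc (u ⊗t v ⊗t w) = u ⊗t (v ⊗t w).
Proof. by rewrite [LHS]tliftE [LHS]tliftE. Qed.

Definition tassocV_in (u : U) (v : V) (w : W) : U ⊗ V ⊗ W := u ⊗t v ⊗t w.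

Lemma tassocV_in_bilinear u : bilinear_for
  (GRing.Scale.Law.clone _ _ *:%R _) (GRing.Scale.Law.clone _ _ *:%R _)
  (tassocV_in u).
Proof.
by split=> [w|v] c x y; rewrite /tassocV_in ?linearPr ?linearPl.
Qed.

HB.instance Definition _ u := bilinear_isBilinear.Build K V W (U ⊗ V ⊗ W)
  _ _ (tassocV_in u) (tassocV_in_bilinear u).

Definition tassocV_fun (u : U) (x : V ⊗ W) := tlift (tassocV_in u) x.

Lemma tassocV_bilinear : bilinear_for
  (GRing.Scale.Law.clone _ _ *:%R _) (GRing.Scale.Law.clone _ _ *:%R _)
  tassocV_fun.
Proof.
split=> [x|u] c y z; rewrite /tassocV_fun ?linearP //=.
elim/(@tensor_ind K V W): x => [v w||d x x' IHx IHx'].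
- by rewrite !tliftE /= /tassocV_in !linearPl.
- by rewrite !linear0 addr0.
- by rewrite !linearP /= IHx IHx' !scalerDr addrACA.
Qed.

HB.instance Definition _ := bilinear_isBilinear.Build K U (V ⊗ W) (U ⊗ V ⊗ W)
  _ _ tassocV_fun tassocV_bilinear.

Definition tassocV : {linear U ⊗ (V ⊗ W) -> U ⊗ V ⊗ W} := tlift tassocV_fun.

Lemma tassocVE u v w : tassocV (u ⊗t (v ⊗t w)) = u ⊗t v ⊗t w.
Proof. by rewrite [LHS]tliftE [LHS]tliftE. Qed.

End TensorAssoc.

(* The algebra K^n; its multiplication and its unit are componentwise.        *)
Notation "K ^^ n" := {ffun 'I_n -> K^o} (at level 30, only parsing) : type_scope.

Definition canon_basis (K : fieldType) n (i : 'I_n) : K ^^ n :=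
  [ffun j => (i == j)%:R].

Section Multiplications.
Variables (K : fieldType).

Definition alg_mul (A : algType K) (a b : A) : A := a * b.

Lemma alg_mul_bilinear (A : algType K) : bilinear_for
  (GRing.Scale.Law.clone _ _ *:%R _) (GRing.Scale.Law.clone _ _ *:%R _)
  (@alg_mul A).
Proof.
split=> [b|a] c x y; rewrite /alg_mul.
  by rewrite mulrDl -scalerAl.
by rewrite mulrDr -scalerAr.
Qed.

HB.instance Definition _ (A : algType K) := bilinear_isBilinear.Build K A A A _ _
  (@alg_mul A) (alg_mul_bilinear A).

Definition alg_m (A : algType K) : {linear A ⊗ A -> A} := tlift (@alg_mul A).

Definition Kn_mul n (x y : K ^^ n) : K ^^ n := x * y.

Lemma Kn_mul_bilinear n : bilinear_for
  (GRing.Scale.Law.clone _ _ *:%R _) (GRing.Scale.Law.clone _ _ *:%R _)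
  (@Kn_mul n).
Proof.
split=> [z|z] c x y; apply/ffunP=> i; rewrite /Kn_mul !ffunE.
  by rewrite mulrDl -scalerAl.
by rewrite mulrDr -scalerAr.
Qed.

HB.instance Definition _ (n : nat) := bilinear_isBilinear.Build K
  (K ^^ n) (K ^^ n) (K ^^ n) _ _ (@Kn_mul n) (@Kn_mul_bilinear n).

Definition Kn_m n : {linear (K ^^ n) ⊗ (K ^^ n) -> K ^^ n} := tlift (@Kn_mul n).

End Multiplications.

Section TwistingMaps.
Variables (K : fieldType) (n : nat) (A : algType K).

Local Notation Kn := (K ^^ n).

(* The associativity isomorphisms, implicit on paper, are written out.        *)
Definition is_twisting (tau : {linear Kn ⊗ A -> A ⊗ Kn}) : Prop :=
  [/\ tau \o tmap (Kn_m K n) idfun =1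
        tmap idfun (Kn_m K n) \o tassoc A Kn Kn \o tmap tau idfun
          \o tassocV Kn A Kn \o tmap idfun tau \o tassoc Kn Kn A,
      tau \o tmap idfun (alg_m A) =1
        tmap (alg_m A) idfun \o tassocV A A Kn \o tmap idfun tau
          \o tassoc A Kn A \o tmap tau idfun \o tassocV Kn A A,
      forall a : A, tau ((1 : Kn) ⊗t a) = a ⊗t (1 : Kn)
    & forall x : Kn, tau (x ⊗t (1 : A)) = (1 : A) ⊗t x].

Definition twisting_maps : set {linear Kn ⊗ A -> A ⊗ Kn} :=
  [set tau | is_twisting tau].

Definition endo_family := 'I_n -> 'I_n -> {linear A -> A}.

Definition endo_family_of (tau : {linear Kn ⊗ A -> A ⊗ Kn}) (E : endo_family) :=
  forall (i : 'I_n) (a : A),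
    tau (canon_basis K i ⊗t a) = \sum_j E i j a ⊗t canon_basis K j.

Section Coordinate.
Variable j : 'I_n.

Definition coord_fun (a : A) (x : Kn) : A := (x j : K) *: a.

Lemma coord_bilinear : bilinear_for
  (GRing.Scale.Law.clone _ _ *:%R _) (GRing.Scale.Law.clone _ _ *:%R _) coord_fun.
Proof.
split=> [x|a] c y z; rewrite /coord_fun /=.
  by rewrite scalerDr !scalerA (mulrC c).
by rewrite !ffunE scalerDl -scalerA.
Qed.

HB.instance Definition _ :=
  bilinear_isBilinear.Build K A Kn A _ _ coord_fun coord_bilinear.

Definition tcoord : {linear A ⊗ Kn -> A} := tlift coord_fun.

End Coordinate.

Lemma canon_basis_sum (x : Kn) : x = \sum_j (x j : K) *: canon_basis K j.
Proof.
apply/ffunP=> i; rewrite sum_ffunE (bigD1 i) //= big1 ?addr0 => [|j ji].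
  by rewrite !ffunE eqxx /GRing.scale /= mulr1.
by rewrite !ffunE (negPf ji) /GRing.scale /= mulr0.
Qed.

Lemma tcoord_sum (x : A ⊗ Kn) : x = \sum_j tcoord j x ⊗t canon_basis K j.
Proof.
elim/(@tensor_ind K A Kn): x => [a x||c x y IHx IHy].
- rewrite {1}(canon_basis_sum x) linear_sumr; apply: eq_bigr => j _.
  by rewrite /tcoord /= tliftE linearZr_LR linearZl_LR.
- by rewrite big1 // => j _; rewrite linear0 linear0l.
- rewrite {1}IHx {1}IHy scaler_sumr -big_split; apply: eq_bigr => j _ /=.
  by rewrite linearP linearPl.
Qed.

Lemma tcoordE (f : 'I_n -> A) j :
  tcoord j (\sum_k f k ⊗t canon_basis K k) = f j.
Proof.
rewrite linear_sum (bigD1 j) //= big1 ?addr0 => [|k kj].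
  by rewrite tliftE /= /coord_fun ffunE eqxx scale1r.
by rewrite tliftE /= /coord_fun ffunE (negPf kj) scale0r.
Qed.

Lemma endo_family_unique tau : exists! E, endo_family_of tau E.
Proof.
pose c i j (a : A) := tcoord j (tau (canon_basis K i ⊗t a)).
have c_lin i j : linear (c i j).
  by move=> k a b; rewrite /c linearPr !linearP.
pose cL i j := GRing.isLinear.Build K A A _ (c i j) (c_lin i j).
pose E i j : {linear A -> A} := HB.pack (c i j) (cL i j).
exists E; split=> [i a|E' E'P]; first exact: tcoord_sum.
apply/funext=> i; apply/funext=> j; apply: linear_ext => a /=.
by rewrite /c E'P tcoordE.
Qed.

Definition endo_family_tau (tau : {linear Kn ⊗ A -> A ⊗ Kn}) : endo_family :=
  sval (cid (endo_family_unique tau)).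

Lemma endo_family_tauP tau : endo_family_of tau (endo_family_tau tau).
Proof. by rewrite /endo_family_tau; case: cid => E []. Qed.

Definition endo_systems : set endo_family :=
  [set E : endo_family |
    [/\ forall i j p (a : A), E i p (E j p a) = (i == j)%:R *: E i p a,
        forall i j (a b : A), E i j (a * b) = \sum_p E i p a * E p j b,
        forall j (a : A), \sum_i E i j a = a
      & forall i j, E i j 1 = (i == j)%:R *: (1 : A)]].

(* A quiver on 'I_n without multiple arrows is its set of (source, target)    *)
(* pairs, so that equality of quivers is equality of sets of arrows.          *)
Definition squiver := {set 'I_n * 'I_n}.

Definition arrow (G : squiver) := {al : 'I_n * 'I_n | al \in G}.
Definition src (G : squiver) (al : arrow G) : 'I_n := (val al).1.
Definition tgt (G : squiver) (al : arrow G) : 'I_n := (val al).2.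

Definition arrows (G : squiver) (i j : 'I_n) : {set arrow G} :=
  [set al | (src al == i) && (tgt al == j)].

Definition paths2 (G : squiver) (i j : 'I_n) : {set arrow G * arrow G} :=
  [set p | [&& src p.1 == i, tgt p.1 == src p.2 & tgt p.2 == j]].

(* The representation has the space A at every vertex.                        *)
Record quiver_rep := QuiverRep {
  quiver_of : squiver;
  rep_map : arrow quiver_of -> {linear A -> A}
}.

Definition splitted (G : squiver) (phi : arrow G -> {linear A -> A}) :=
  (forall i (al' al'' : arrow G), tgt al' = i -> tgt al'' = i ->
     forall a, phi al' (phi al'' a) = (src al' == src al'')%:R *: phi al' a)
  /\ (forall i a, \sum_(al : arrow G | tgt al == i) phi al a = a).

Definition unital (G : squiver) (phi : arrow G -> {linear A -> A}) :=
  forall al, phi al 1 = (src al == tgt al)%:R *: (1 : A).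

Definition factorizable (G : squiver) (phi : arrow G -> {linear A -> A}) :=
  forall i j (a b : A),
    (forall al, arrows G i j = [set al] ->
       \sum_(p in paths2 G i j) phi p.1 a * phi p.2 b = phi al (a * b))
    /\ (arrows G i j = finset.set0 ->
       \sum_(p in paths2 G i j) phi p.1 a * phi p.2 b = 0).

Definition admissible_pairs : set quiver_rep :=
  [set GR | let: QuiverRep G phi := GR in
     [/\ forall i, exists al : arrow G, src al = i /\ tgt al = i,
         forall al, (phi al : A -> A) <> (fun=> 0),
         splitted phi, unital phi & factorizable phi]].

Definition family_quiver (E : endo_family) : squiver :=
  [set ij | `[< (E ij.1 ij.2 : A -> A) <> (fun=> 0) >]].

Definition family_rep (E : endo_family) : quiver_rep :=
  @QuiverRep (family_quiver E) (fun al => E (src al) (tgt al)).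

End TwistingMaps.

Arguments twisting_maps {K} n A _.
Arguments endo_systems {K} n A _.
Arguments admissible_pairs {K} n A _.
Arguments endo_family_tau {K} n A tau.
Arguments family_rep {K} n A E.

(* Main.v *)
(* Every element of A ⊗ K^n is uniquely a sum of a_j ⊗ e_j. Evaluating the     *)
(* axioms of a twisting map on tensors of basis vectors e_i with elements of A *)
(* and comparing coefficients of the e_j turns them one by one into the axioms *)
(* of a system of endomorphisms.                                               *)
(* Representations of quivers without multiple arrows by nonzero maps amount   *)
(* to families (E_ij), the absent arrows being the zero entries: extension by  *)
(* zero inverts E |-> (Gamma_E, R_E). It identifies sums over arrows and over  *)
(* paths of length two with sums over indices, and hence the two lists of      *)
(* axioms; the loops come from E_ii(1) = 1 <> 0.                               *)
Require Import Defs.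
From HB Require Import structures.
From mathcomp Require Import all_boot all_order all_algebra.
From mathcomp Require Import boolp.
From mathcomp Require Import classical_sets functions.

Set Implicit Arguments.
Unset Strict Implicit.
Unset Printing Implicit Defensive.

Import GRing.Theory.
Local Open Scope ring_scope.

(** A linear map tau is the same thing as a matrix (E_ij), because the elements of A ⊗ K^n have
    unique coordinates along the e_j ([tcoord_sum], [tcoordE]). Since e_p e_q = delta_pq e_p,
    compatibility with the product of K^n reads E_ip E_jp = delta_ij E_ip; compatibility with the
    product of A is a matrix-product rule; the two unit axioms give column sums Id and E_ij(1) =
    delta_ij. This is [is_twistingP]. A matrix of maps is also the same thing as the quiver of its
    nonzero entries labelled by them ([family_repK], [rep_familyK]). [splittedP], [unitalP] and
    [factorizableP] translate the axioms for any E that extends phi by zero, so they serve both for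
    the quiver of a family and for the family of a quiver. *)

Section Twisting.
Variables (K : fieldType) (n : nat) (A : algType K).
Local Notation Kn := (K ^^ n).
Local Notation e := (@canon_basis K n).

Lemma Kn_m_basis i j : Kn_m K n (e i ⊗t e j) = (i == j)%:R *: e i.
Proof.
rewrite [LHS]tliftE /= /Kn_mul; apply/ffunP=> k; rewrite !ffunE.
have [<-|ij] := eqVneq i j; first by case: (i == k); rewrite ?mulr1 ?mulr0 scale1r.
rewrite scale0r; case: (eqVneq i k) => [<-|_]; last by rewrite mul0r.
by rewrite eq_sym (negPf ij) mulr0.
Qed.

Lemma alg_mE (a b : A) : alg_m A (a ⊗t b) = a * b.
Proof. exact: tliftE. Qed.

Lemma sum_canon_basis : \sum_i e i = (1 : Kn).
Proof.
rewrite [RHS]canon_basis_sum; apply: eq_bigr => i _.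
by rewrite ffunE scale1r.
Qed.

Lemma Kn_tensor_ext (V W : lmodType K) (f g : {linear Kn ⊗ V -> W}) :
  (forall i v, f (e i ⊗t v) = g (e i ⊗t v)) -> f =1 g.
Proof.
move=> fg; apply: tensor_ext => x v.
rewrite (canon_basis_sum x) linear_sumlz !linear_sum; apply: eq_bigr => i _.
by rewrite linearZl_LR !linearZ fg.
Qed.

Lemma Kn_tensor2_ext (V W : lmodType K) (f g : {linear Kn ⊗ Kn ⊗ V -> W}) :
  (forall i j v, f (e i ⊗t e j ⊗t v) = g (e i ⊗t e j ⊗t v)) -> f =1 g.
Proof.
move=> fg; apply: tensor_ext => x v.
elim/(@tensor_ind K Kn Kn): x => [x y||c x y IHx IHy].
- rewrite (canon_basis_sum x) (canon_basis_sum y).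
  rewrite linear_sumlz linear_sumlz !linear_sum; apply: eq_bigr => i _.
  rewrite linear_sumr linear_sumlz !linear_sum; apply: eq_bigr => j _.
  by rewrite !(linearZl_LR, linearZr_LR) !linearZ fg.
- by rewrite linear0l !linear0.
- by rewrite linearPl !linearP IHx IHy.
Qed.

Lemma Kn_tensorA_ext (U V W : lmodType K) (f g : {linear Kn ⊗ (U ⊗ V) -> W}) :
  (forall i u v, f (e i ⊗t (u ⊗t v)) = g (e i ⊗t (u ⊗t v))) -> f =1 g.
Proof.
move=> fg; apply: Kn_tensor_ext => i x.
elim/(@tensor_ind K U V): x => [x y||c x y IHx IHy]; first exact: fg.
- by rewrite linear0r !linear0.
- by rewrite linearPr !linearP IHx IHy.
Qed.

Lemma tensor_basis_inj (f g : 'I_n -> A) :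
  \sum_j f j ⊗t e j = \sum_j g j ⊗t e j -> f =1 g.
Proof. by move=> fg j; rewrite -(tcoordE f) fg tcoordE. Qed.

(** * The twisting axioms in coordinates *)

Section Family.
Variables (tau : {linear Kn ⊗ A -> A ⊗ Kn}) (E : endo_family n A).
Hypothesis tauE : endo_family_of tau E.

Lemma twisting_oneKnE a :
  tau ((1 : Kn) ⊗t a) = \sum_j (\sum_i E i j a) ⊗t e j.
Proof.
rewrite -sum_canon_basis linear_sumlz linear_sum /=.
under eq_bigr do rewrite tauE; under [RHS]eq_bigr do rewrite linear_sumlz.
by rewrite exchange_big.
Qed.

Lemma tensor_oneKn (a : A) : a ⊗t (1 : Kn) = \sum_j a ⊗t e j.
Proof. by rewrite -sum_canon_basis linear_sumr. Qed.

Lemma twisting_mulKnE i j a :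
  (tmap idfun (Kn_m K n) \o tassoc A Kn Kn \o tmap tau idfun
     \o tassocV Kn A Kn \o tmap idfun tau \o tassoc Kn Kn A) (e i ⊗t e j ⊗t a)
  = \sum_p E i p (E j p a) ⊗t e p.
Proof.
rewrite /= tassocE tmapE tauE linear_sumr !linear_sum.
apply: eq_bigr => p _; rewrite tassocVE tmapE tauE linear_sumlz !linear_sum /=.
(* Only the term q = p survives, the e_q being orthogonal idempotents; hence both maps in the result
   have the same second index. *)
rewrite (bigD1 p) //= big1 ?addr0 => [|q qp]; rewrite tassocE tmapE.
  by rewrite Kn_m_basis eqxx scale1r.
by rewrite Kn_m_basis (negPf qp) scale0r linear0r.
Qed.

Lemma twisting_mulAE i a b :
  (tmap (alg_m A) idfun \o tassocV A A Kn \o tmap idfun tau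
     \o tassoc A Kn A \o tmap tau idfun \o tassocV Kn A A) (e i ⊗t (a ⊗t b))
  = \sum_j (\sum_p E i p a * E p j b) ⊗t e j.
Proof.
rewrite /= tassocVE tmapE tauE linear_sumlz !linear_sum.
under [RHS]eq_bigr do rewrite linear_sumlz.
rewrite exchange_big; apply: eq_bigr => p _ /=.
rewrite tassocE tmapE tauE linear_sumr !linear_sum; apply: eq_bigr => j _ /=.
by rewrite tassocVE tmapE alg_mE.
Qed.

Lemma is_twistingP : is_twisting tau <-> endo_systems n A E.
Proof.
split=> [[tauM tauMA tau1 tauA1]|[EE EM E1 EA1]].
  split.
  - move=> i j p a; move: p.
    apply: (tensor_basis_inj (f := fun p => E i p (E j p a))).
    have := tauM (e i ⊗t e j ⊗t a); rewrite twisting_mulKnE => <-.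
    rewrite /= tmapE Kn_m_basis linearZl_LR linearZ /= tauE.
    by rewrite scaler_sumr; apply: eq_bigr => p _; rewrite linearZl_LR.
  - move=> i j a b; move: j; apply: (tensor_basis_inj (f := fun j => E i j _)).
    have := tauMA (e i ⊗t (a ⊗t b)); rewrite twisting_mulAE => <-.
    by rewrite /= tmapE alg_mE tauE.
  - move=> j a; move: j.
    apply: (tensor_basis_inj (f := fun j => \sum_i E i j a)).
    by rewrite -twisting_oneKnE tau1 tensor_oneKn.
  - move=> i; apply: (tensor_basis_inj (f := fun j => E i j 1)).
    rewrite -tauE tauA1 (bigD1 i) //= big1 ?eqxx ?scale1r ?addr0 // => j ji.
    by rewrite eq_sym (negPf ji) scale0r linear0l.
split.
- apply: Kn_tensor2_ext => i j a; rewrite [RHS]twisting_mulKnE.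
  rewrite /= tmapE Kn_m_basis linearZl_LR linearZ /= tauE.
  by rewrite scaler_sumr; apply: eq_bigr => p _; rewrite EE linearZl_LR.
- apply: Kn_tensorA_ext => i a b; rewrite [RHS]twisting_mulAE.
  rewrite /= tmapE alg_mE tauE.
  by apply: eq_bigr => j _; rewrite -EM.
- move=> a; rewrite twisting_oneKnE tensor_oneKn.
  by apply: eq_bigr => j _; rewrite E1.
- move=> x; rewrite (canon_basis_sum x) linear_sumlz linear_sumr linear_sum /=.
  apply: eq_bigr => i _; rewrite linearZl_LR linearZ /= linearZr_LR /= tauE.
  congr (_ *: _); rewrite (bigD1 i) //= big1 ?addr0 => [|j ji].
    by rewrite EA1 eqxx scale1r.
  by rewrite EA1 eq_sym (negPf ji) scale0r linear0l.
Qed.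
End Family.
End Twisting.

(** * The linear map with a prescribed matrix *)

Section TwistingOfFamily.
Variables (K : fieldType) (n : nat) (A : algType K).
Local Notation Kn := (K ^^ n).
Local Notation e := (@canon_basis K n).
Variable E : endo_family n A.

Definition family_tw_fun (x : Kn) (a : A) : A ⊗ Kn :=
  \sum_i (x i : K) *: \sum_j E i j a ⊗t e j.

Lemma family_tw_bilinear : bilinear_for
  (GRing.Scale.Law.clone _ _ *:%R _) (GRing.Scale.Law.clone _ _ *:%R _)
  family_tw_fun.
Proof.
split=> [a|x] c u v; rewrite /family_tw_fun /= scaler_sumr -big_split;
  apply: eq_bigr => i _ /=.
  by rewrite !ffunE scalerDl scalerA.
rewrite scalerA mulrC -scalerA -scalerDr; congr (_ *: _).
rewrite scaler_sumr -big_split; apply: eq_bigr => j _ /=.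
by rewrite linearP linearPl.
Qed.

HB.instance Definition _ := bilinear_isBilinear.Build K Kn A (A ⊗ Kn)

  _ _ family_tw_fun family_tw_bilinear.

Definition family_tw : {linear Kn ⊗ A -> A ⊗ Kn} := tlift family_tw_fun.

Lemma family_twP : endo_family_of family_tw E.
Proof.
move=> i a; transitivity (family_tw_fun (e i) a); first exact: tliftE.
rewrite /family_tw_fun (bigD1 i) //= [X in _ + X]big1 => [|j ji].
  by rewrite addr0 ffunE eqxx scale1r.
by rewrite ffunE eq_sym (negPf ji) scale0r.
Qed.

End TwistingOfFamily.

Section Bijections.
Variables (K : fieldType) (n : nat) (A : algType K).

Lemma endo_family_tau_bij :
  set_bij (twisting_maps n A) (endo_systems n A) (endo_family_tau n A).
Proof.
split=> [tau /= tauT|tau tau' _ _ eq_E|E EE].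
- exact/(is_twistingP (endo_family_tauP tau)).
- apply: linear_ext; apply: Kn_tensor_ext => i a.
  by rewrite !endo_family_tauP eq_E.
(* Both E and the chosen family of [family_tw E] represent this map, so both equal F. *)
- have [F [_ uniqF]] := endo_family_unique (family_tw E).
  exists (family_tw E).
    exact/(is_twistingP (family_twP E)).
  by rewrite -(uniqF _ (endo_family_tauP _)) -(uniqF _ (family_twP E)).
Qed.

(** * Axioms of a representation against those of its extension by zero *)

Section Extension.
Variables (G : squiver n) (phi : arrow G -> {linear A -> A}).
Variable E : endo_family n A.
Hypothesis phiE : forall al, phi al =1 E (src al) (tgt al).
Hypothesis notGE : forall i j, (i, j) \notin G -> E i j =1 (fun=> 0).

Lemma sum_arrow (V : nmodType) (P : pred ('I_n * 'I_n)) (F : 'I_n * 'I_n -> V) :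
  (forall ij, ij \notin G -> F ij = 0) ->
  \sum_(al : arrow G | P (val al)) F (val al) = \sum_(ij | P ij) F ij.
Proof.
move=> F0; rewrite [RHS](bigID [in G]) /= [X in _ = _ + X]big1 ?addr0;
  last by move=> ij /andP[_ /F0].
rewrite [RHS](reindex_omap (val : arrow G -> _) insub) /=.
  by apply: eq_bigl => al; rewrite (valP al) andbT valK eqxx andbT.
by move=> ij /andP[_ ijG]; rewrite insubT.
Qed.

Lemma sum_into i a : \sum_(al : arrow G | tgt al == i) phi al a = \sum_s E s i a.
Proof.
under eq_bigr do rewrite phiE.
rewrite (sum_arrow (fun x => x.2 == i) (F := fun x => E x.1 x.2 a)) => [|[k l] /=];
  last by move/notGE->.
rewrite -(pair_big_dep xpredT (fun _ y => y == i) (fun x y => E x y a)) /=.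
by apply: eq_bigr => s _; rewrite big_pred1_eq.
Qed.

(** A path of length two from i to j is determined by its middle vertex q; a q that is not reached
    contributes 0, since E i q or E q j then vanishes. *)
Lemma sum_paths2 i j a b :
  \sum_(p in paths2 G i j) phi p.1 a * phi p.2 b = \sum_q E i q a * E q j b.
Proof.
pose P (x y : 'I_n * 'I_n) := [&& x.1 == i, x.2 == y.1 & y.2 == j].
pose F (x y : 'I_n * 'I_n) := E x.1 x.2 a * E y.1 y.2 b.
transitivity (\sum_(p : arrow G * arrow G | P (val p.1) (val p.2))
    F (val p.1) (val p.2)).
  by apply: eq_big => [p|p _]; rewrite ?inE // !phiE.
rewrite -(pair_big_dep xpredT (fun x y : arrow G => P (val x) (val y))
  (fun x y => F (val x) (val y))) /=.
rewrite (eq_bigr (fun x : arrow G => \sum_(y | P (val x) y) F (val x) y)); last first.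
  move=> x _; rewrite (sum_arrow (P (val x)) (F := F (val x))) // => -[k l] /notGE E0.
  by rewrite /F /= E0 mulr0.
rewrite (sum_arrow xpredT (F := fun x => \sum_(y | P x y) F x y)); last first.
  by move=> [k l] /notGE E0; rewrite big1 // => y _; rewrite /F /= E0 mul0r.
(* Eta-expanding the pair lets the sum split into a double sum over source and target. *)
rewrite (eq_bigr (fun x => \sum_(y | P (x.1, x.2) y) F (x.1, x.2) y)); last by case.
rewrite -(pair_bigA _ (fun k l => \sum_(y | P (k, l) y) F (k, l) y)) /=.
rewrite (bigD1 i) //= [X in _ + X]big1 ?addr0 => [|k ki]; last first.
  by apply: big1 => l _; apply: big1 => y; rewrite /P /= (negPf ki).
apply: eq_bigr => q _; rewrite (big_pred1 (q, j)) // => -[k l].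
by rewrite /P /= eqxx /= xpair_eqE eq_sym.
Qed.

Lemma arrows_in i j (ijG : (i, j) \in G) :
  arrows G i j = [set (exist _ (i, j) ijG : arrow G)].
Proof.
apply/setP => al; rewrite !inE /src /tgt -xpair_eqE -surjective_pairing.
by rewrite -[RHS](inj_eq val_inj).
Qed.

Lemma arrows_notin i j : (i, j) \notin G -> arrows G i j = finset.set0.
Proof.
move=> ijG; apply/setP => al; rewrite !inE; apply: contraNF ijG.
by rewrite /src /tgt -xpair_eqE -surjective_pairing => /eqP <-; apply: valP.
Qed.

Lemma splittedP :
  splitted phi <->
  (forall i j p a, E i p (E j p a) = (i == j)%:R *: E i p a) /\
  (forall j a, \sum_i E i j a = a).
Proof.
split=> [[phi2 phi1]|[E2 E1]]; split.
- move=> i j p a; have [ipG|/notGE ip0] := boolP ((i, p) \in G); last first.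
    by rewrite !ip0 scaler0.
  (* If (j, p) is absent, the left side is 0; the right side can only survive for i = j, where
     [E i p] is that same zero entry. *)
  have [jpG|/notGE jp0] := boolP ((j, p) \in G); last first.
    rewrite jp0 linear0; have [ij|_] := eqVneq i j; last by rewrite scale0r.
    by rewrite ij jp0 scaler0.
  have := phi2 p (exist _ (i, p) ipG) (exist _ (j, p) jpG) erefl erefl a.
  by rewrite !phiE.
- by move=> j a; rewrite -sum_into phi1.
- by move=> i al al' <- t a; rewrite !phiE t E2.
- by move=> i a; rewrite sum_into E1.
Qed.

(** An absent arrow forces the value 0 at 1, which agrees with delta_ij off the diagonal only; the
    loops cover the diagonal. *)
Lemma unitalP : (forall i, (i, i) \in G) ->
  unital phi <-> (forall i j, E i j 1 = (i == j)%:R *: (1 : A)).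
Proof.
move=> loopG; split=> [phi1 i j|E1 al]; last by rewrite phiE E1.
have [ijG|ijG] := boolP ((i, j) \in G).
  by have := phi1 (exist _ (i, j) ijG); rewrite phiE.
have [ij|_] := eqVneq i j; first by rewrite ij loopG in ijG.
by rewrite (notGE ijG) scale0r.
Qed.

Lemma factorizableP :
  factorizable phi <->
  (forall i j a b, E i j (a * b) = \sum_p E i p a * E p j b).
Proof.
split=> [phiM i j a b|EM i j a b].
  rewrite -sum_paths2; have [phi1 phi0] := phiM i j a b.
  have [ijG|ijG] := boolP ((i, j) \in G).
    by rewrite (phi1 _ (arrows_in ijG)) phiE.
  by rewrite (phi0 (arrows_notin ijG)) (notGE ijG).
rewrite sum_paths2 -EM; split=> [al alE|ij0].
  have: al \in arrows G i j by rewrite alE inE.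
  by rewrite inE phiE => /andP[/eqP -> /eqP ->].
apply: notGE; apply/negP => ijG.
have: (exist _ (i, j) ijG : arrow G) \in arrows G i j by rewrite arrows_in inE.
by rewrite ij0 inE.
Qed.

End Extension.

(** * Families of endomorphisms and admissible pairs *)

Lemma endo_system_diag_neq0 E i :
  endo_systems n A E -> (E i i : A -> A) <> (fun=> 0).
Proof.
case=> _ _ _ E1 Ei0; have := E1 i i.
by rewrite Ei0 eqxx scale1r => /esym/eqP; rewrite oner_eq0.
Qed.

Lemma notin_family_quiver (E : endo_family n A) i j :
  (i, j) \notin family_quiver E -> E i j =1 (fun=> 0).
Proof. by rewrite inE => /asboolPn/contrapT ->. Qed.

Lemma family_rep_admissible E :
  endo_systems n A E -> admissible_pairs n A (family_rep n A E).
Proof.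
move=> EE; have loops i : (i, i) \in family_quiver E.
  by rewrite inE; apply/asboolP/endo_system_diag_neq0.
have ext (al : arrow (family_quiver E)) : E (src al) (tgt al) =1 E (src al) (tgt al).
  by [].
have notG := @notin_family_quiver E; case: EE => E2 EM E1 EA1; split.
- by move=> i; exists (exist _ (i, i) (loops i)).
- by move=> al; have := valP al; rewrite inE => /asboolP.
- exact/(splittedP ext notG).
- exact/(unitalP ext notG loops).
- exact/(factorizableP ext notG).
Qed.

Definition rep_family (GR : quiver_rep n A) : endo_family n A :=
  fun i j => if insub (i, j) is Some al then rep_map (al : arrow (quiver_of GR))
             else \0%R.

Lemma rep_familyE (GR : quiver_rep n A) (al : arrow (quiver_of GR)) :
  rep_family GR (src al) (tgt al) = rep_map al.
Proof. by rewrite /rep_family -surjective_pairing valK. Qed.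

Lemma rep_family_notin (GR : quiver_rep n A) i j :
  (i, j) \notin quiver_of GR -> rep_family GR i j = \0%R.
Proof. by move=> ijG; rewrite /rep_family insubN. Qed.

Lemma family_repK : cancel (family_rep n A) rep_family.
Proof.
move=> E; apply/funext=> i; apply/funext=> j.
have [ijG|ijG] := boolP ((i, j) \in quiver_of (family_rep n A E)).
  exact: (rep_familyE (exist _ (i, j) ijG)).
rewrite rep_family_notin //; apply: linear_ext => a.
by rewrite (notin_family_quiver ijG).
Qed.

(** The type of phi depends on G, so the maps are compared at arrows with the same pair of
    endpoints, which avoids transport along G = G'. *)
Lemma quiver_rep_eq (G G' : squiver n) (phi : arrow G -> {linear A -> A})
    (phi' : arrow G' -> {linear A -> A}) : G = G' ->
  (forall al al', val al = val al' -> phi al = phi' al') ->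
  QuiverRep phi = QuiverRep phi'.
Proof.
move=> eqG; case: G' / eqG phi' => phi' eq_phi; congr QuiverRep.
by apply/funext=> al; apply: eq_phi.
Qed.

(** Extension by zero forgets whether a zero entry was an arrow; maps that are all nonzero leave no
    such ambiguity. *)
Lemma rep_familyK (GR : quiver_rep n A) :
  (forall al : arrow (quiver_of GR), (rep_map al : A -> A) <> (fun=> 0)) ->
  family_rep n A (rep_family GR) = GR.
Proof.
case: GR => G phi neq0; apply: quiver_rep_eq => [|al al' eq_al]; last first.
  by rewrite /src /tgt eq_al; exact: (@rep_familyE (QuiverRep phi) al').
apply/setP=> -[i j]; rewrite inE; apply/asboolP/idP => /= [|ijG].
  by apply: contra_notT => /(@rep_family_notin (QuiverRep phi)) ->.
have := @rep_familyE (QuiverRep phi) (exist _ (i, j) ijG).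
by rewrite /src /tgt /= => ->; apply: neq0.
Qed.

Lemma rep_family_system GR :
  admissible_pairs n A GR -> endo_systems n A (rep_family GR).
Proof.
case: GR => G phi [loops _ phiS phiU phiF].
have loopG i : (i, i) \in G.
  have [al [src_al tgt_al]] := loops i; have := valP al.
  by rewrite [val al]surjective_pairing -/(src al) -/(tgt al) src_al tgt_al.
pose E := rep_family (QuiverRep phi).
have ext al : phi al =1 E (src al) (tgt al).
  by move=> a; rewrite /E (@rep_familyE (QuiverRep phi)).
have notG i j : (i, j) \notin G -> E i j =1 (fun=> 0).
  by move=> ijG a; rewrite /E (@rep_family_notin (QuiverRep phi)).
have [E2 E1] := (splittedP ext notG).1 phiS.
by split=> //; [exact/(factorizableP ext notG)|exact/(unitalP ext notG loopG)].
Qed.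

Lemma family_rep_bij :
  set_bij (endo_systems n A) (admissible_pairs n A) (family_rep n A).
Proof.
split=> [E|E E' _ _|GR adm]; first exact: family_rep_admissible.
  exact: (can_inj family_repK).
exists (rep_family GR); first exact: rep_family_system.
by apply: rep_familyK; case: GR adm => G phi [].
Qed.

End Bijections.

Theorem theorem1p8 (K : fieldType) (A : algType K) (n : nat) (n_ge1 : (1 <= n)%N) :
  set_bij (twisting_maps n A) (endo_systems n A) (endo_family_tau n A) /\
  set_bij (endo_systems n A) (admissible_pairs n A) (family_rep n A).
Proof. by split; [exact: endo_family_tau_bij | exact: family_rep_bij]. Qed.
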